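(* Let $Q$ be a process on $A^{\mathbb{Z}}$ and $\Theta\subseteq\mathcal{P}_{\mathrm{erg}}(A^{\mathbb{Z}})$ such that $h(P,Q)$ exists for all $P\in\Theta$. The following are equivalent: 1. $\bar\beta_\varepsilon(P,Q)\le -h(P,Q)$ for all $P\in\Theta$ and all $\varepsilon\in(0,1)$. 2. For every $\Omega\subseteq\Theta$ and every $\eta>0$ there are subsets $M_n\subseteq A^n$ with $\lim_{n}P^{(n)}(M_n)=1$ for all $P\in\Omega$ and with $\limsup_n\frac1n\log Q^{(n)}(M_n)\le -h(\Omega,Q)+\eta$ if $h(\Omega,Q)<\infty$, resp. $\limsup_n\frac1n\log Q^{(n)}(M_n)\le -1/\eta$ if $h(\Omega,Q)=\infty$; and moreover every sequence $\tilde M_n\subseteq A^n$ with $\lim_n P^{(n)}(\tilde M_n)=1$ for all $P\in\Omega$ satisfies $\liminf_n\frac1n\log Q^{(n)}(\tilde M_n)\ge -h(\Omega,Q)$.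
   Context: $A$ is a finite set; a process is a probability measure on $A^{\mathbb{Z}}$ with the product $\sigma$-field generated by cylinders. $P^{(n)}$ denotes the marginal of $P$ on coordinates $\{0,\dots,n-1\}$, a probability on $A^n$. $\mathcal{P}_{\mathrm{erg}}(A^{\mathbb{Z}})$ is the set of shift-ergodic processes. $H(\cdot,\cdot)$ is the relative entropy (Kullback–Leibler divergence) of probability measures on a finite set; $h(P,Q):=\lim_n\frac1nH(P^{(n)},Q^{(n)})$ when the limit exists in $[0,+\infty]$, and $h(\Omega,Q):=\inf_{P\in\Omega}h(P,Q)$. For $\varepsilon\in(0,1)$, $\beta_{\varepsilon,n}(P,Q):=\min\{\log Q^{(n)}(M):M\subseteq A^n,\ P^{(n)}(M)\ge1-\varepsilon\}$ and $\bar\beta_\varepsilon(P,Q):=\limsup_n\frac1n\beta_{\varepsilon,n}(P,Q)$. *)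

(* Defs.v *)
From HB Require Import structures.
From mathcomp Require Import all_boot all_order all_algebra.
From mathcomp Require Import all_classical all_reals all_analysis.
Unset Printing Implicit Defensive.
Import Order.TTheory GRing.Theory Num.Theory numFieldNormedType.Exports.
Local Open Scope classical_set_scope.
Local Open Scope ring_scope.

(** The sequence space A^Z.  The point [a0 : A] is only used to equip the
    space with the (pointed) structure required by MathComp-Analysis'
    generated sigma-algebra; it plays no mathematical role. *)
Definition seqZ {A : finType} (a0 : A) : Type := int -> A.
HB.instance Definition _ {A : finType} (a0 : A) := Choice.on (seqZ a0).
HB.instance Definition _ {A : finType} (a0 : A) :=
  isPointed.Build (seqZ a0) (fun _ => a0).

Definition cylinders {A : finType} (a0 : A) : set (set (seqZ a0)) :=
  [set C | exists (m : int) (n : nat) (w : n.-tuple A),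
     C = [set x : seqZ a0 | forall i : 'I_n, x (m + (i : nat)%:Z)%R = tnth w i]].

Definition AZ {A : finType} (a0 : A) := g_sigma_algebraType (cylinders a0).

Definition process {A : finType} (a0 : A) (R : realType) :=
  probability (AZ a0) R.

Definition shift {A : finType} (a0 : A) (x : AZ a0) : AZ a0 :=
  fun i => x (i + 1)%R.

Definition ergodic {A : finType} {a0 : A} {R : realType} (P : process a0 R) :
  Prop :=
  (forall S : set (AZ a0), measurable S -> P (shift a0 @^-1` S) = P S) /\
  (forall S : set (AZ a0), measurable S -> shift a0 @^-1` S = S ->
     P S = 0%E \/ P S = 1%E).

Definition proj {A : finType} (a0 : A) (n : nat) (x : AZ a0) : n.-tuple A :=
  [tuple x (i : nat)%:Z | i < n].

Definition marg {A : finType} {a0 : A} {R : realType} (P : process a0 R)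
  {n : nat} (M : {set n.-tuple A}) : R :=
  fine (P (proj a0 n @^-1` [set w | w \in M])).

Definition elog {R : realType} (x : R) : \bar R :=
  if (0 < x)%R then (ln x)%:E else -oo%E.

Definition relent {R : realType} {T : finType} (p q : T -> R) : \bar R :=
  (\sum_(x : T) (if (p x == 0)%R then 0%E
                 else if (q x == 0)%R then +oo%E
                 else (p x * ln (p x / q x))%:E))%E.

Definition relent_rate {A : finType} {a0 : A} {R : realType}
  (P Q : process a0 R) (n : nat) : \bar R :=
  ((n%:R^-1)%:E *
   relent (fun w : n.-tuple A => marg P [set w])
          (fun w : n.-tuple A => marg Q [set w]))%E.

(** h(P,Q) exists: the limit of (1/n) H(P^(n),Q^(n)) exists in the
    extended reals (it is automatically in [0,+oo]). *)
Definition h_exists {A : finType} {a0 : A} {R : realType} (P Q : process a0 R)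
  : Prop := exists l : \bar R, relent_rate P Q n @[n --> \oo] --> l.

Definition hrate {A : finType} {a0 : A} {R : realType} (P Q : process a0 R)
  : \bar R := limn (relent_rate P Q).

Definition hset {A : finType} {a0 : A} {R : realType}
  (Om : set (process a0 R)) (Q : process a0 R) : \bar R :=
  ereal_inf [set hrate P Q | P in Om].

Definition beta {A : finType} {a0 : A} {R : realType} (eps : R)
  (P Q : process a0 R) (n : nat) : \bar R :=
  ereal_inf [set elog (marg Q M) |
             M in [set M : {set n.-tuple A} | (1 - eps <= marg P M)%R]].

Definition betabar {A : finType} {a0 : A} {R : realType} (eps : R)
  (P Q : process a0 R) : \bar R :=
  limn_esup (fun n => ((n%:R^-1)%:E * beta eps P Q n)%E).

Definition lograte {A : finType} {a0 : A} {R : realType} (Q : process a0 R)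
  (M : forall n : nat, {set n.-tuple A}) (n : nat) : \bar R :=
  ((n%:R^-1)%:E * elog (marg Q (M n)))%E.

(* Main.v *)
Require Import Defs.
From HB Require Import structures.
From mathcomp Require Import all_boot all_order all_algebra.
From mathcomp Require Import all_classical all_reals all_analysis.
From mathcomp Require Import ring lra.
Import Order.TTheory GRing.Theory Num.Theory numFieldNormedType.Exports.
Local Open Scope classical_set_scope.
Local Open Scope ring_scope.

(** The crux is to find sets [M_n] that serve uncountably many sources [P] at
    once.  Stein's property (1) says that, for [P]-most words [w],
    [P w >= exp (n (h(P,Q) - o(1))) * Q w].  On the other hand there is a
    countable family of sub-probabilities [U_j] on words (independent blocks
    with rational block law) such that every stationary [P] satisfies
    [P w <= exp (n t) * U_j w] for [P]-most [w] and some [j]: the relative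
    entropy [H(P^(n), U_j)] is at most [n d + C] as soon as the block length
    nearly attains the infimum of the entropy per letter of [P] and the block
    law is close to that of [P].  Hence
    [M_n = {w | Q w <= exp (- n c) * U_j w for some j < n}] is typical for every
    [P] with [h(P,Q) > c], whereas [Q M_n <= n * exp (- n c)].  Of ergodicity
    only stationarity matters.  The lower bound is the data-processing
    inequality [H(P,Q) >= - P(M) ln Q(M) - 1], and (2) implies (1) by taking
    [Omega] a singleton. *)

(** * Gibbs-type inequalities on a finite set *)

(** For [p > 0] this is [ln y <= y - 1] at [y = u / p]. The bound is linear in [p] and [u], so it
    sums up without normalising [u]. *)
Lemma mul_ln_div_ge {R : realType} (p u : R) :
  0 <= p -> 0 < u -> p - u <= p * ln (p / u).
Proof.
rewrite le_eqVlt => /predU1P[<- u0|p0 u0]; first by rewrite mul0r; lra.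
have pu0 : 0 < p / u by rewrite divr_gt0.
have : ln ((p / u)^-1) <= (p / u)^-1 - 1.
  have := @le_ln1Dx R ((p / u)^-1 - 1).
  rewrite addrCA subrr addr0; apply.
  by have : 0 < (p / u)^-1 by [rewrite invr_gt0]; lra.
rewrite lnV ?posrE// => h.
have := ler_wpM2l (ltW p0) h.
rewrite invf_div mulrBr mulr1 mulrCA divff ?gt_eqF// mulr1.
lra.
Qed.

Lemma sum_mul_ln_div_ge {R : realType} {T : finType} (p u : T -> R) :
  (forall x, 0 <= p x) -> (forall x, 0 <= u x) ->
  (forall x, p x != 0 -> u x != 0) ->
  \sum_x p x - \sum_x u x <= \sum_x p x * ln (p x / u x).
Proof.
move=> p0 u0 pu; rewrite -sumrB; apply: ler_sum => x _.
have [px0|px0] := eqVneq (p x) 0; first by rewrite px0 mul0r sub0r oppr_le0.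
by apply: mul_ln_div_ge => //; rewrite lt_def pu// u0.
Qed.

(** A Markov inequality for the log-likelihood ratio: adding [u x] makes every summand nonnegative,
    at a total cost of at most 1, and on the tail [ln (p x / u x)] is at least [t]. *)
Lemma likelihood_ratio_tail {R : realType} {T : finType} (p u : T -> R)
    (t : R) :
  (forall x, 0 <= p x) -> (forall x, 0 < u x) -> \sum_x u x <= 1 ->
  t * (\sum_(x | u x < expR (- t) * p x) p x) <=
    \sum_x p x * ln (p x / u x) + 1.
Proof.
move=> p0 u0 su.
apply: (@le_trans _ _ (\sum_x (p x * ln (p x / u x) + u x))); last first.
  by rewrite big_split/= lerD2l.
rewrite mulr_sumr big_mkcond/=; apply: ler_sum => x _.
case: ifPn => [lt_up|_]; last first.
  by have := mul_ln_div_ge (p x) (u x) (p0 x) (u0 x); have := p0 x; lra.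
have px0 : 0 < p x.
  rewrite lt_def p0 andbT; apply/eqP => px0; move: lt_up.
  by rewrite px0 mulr0 ltNge (ltW (u0 x)).
have : t <= ln (p x / u x).
  rewrite -[t]expRK ler_ln ?posrE ?expR_gt0 ?divr_gt0//.
  rewrite ler_pdivlMr//.
  have := ltW lt_up; rewrite expRN mulrC ler_pdivlMr ?expR_gt0//.
  by rewrite mulrC.
move=> /(ler_wpM2l (ltW px0)).
by have := u0 x; lra.
Qed.

Lemma relent_lty {R : realType} {T : finType} (p q : T -> R) :
  (relent p q < +oo)%E -> forall x, p x != 0 -> q x != 0.
Proof.
move=> + x px; apply: contraTN => /eqP qx.
rewrite -leNgt /relent (bigD1 x)//= (negbTE px) qx eqxx.
rewrite addye//.
apply/eqP => /esum_eqNyP[y [_ _]].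
by case: ifP => // _; case: ifP.
Qed.

Lemma relentE {R : realType} {T : finType} (p q : T -> R) :
  (forall x, p x != 0 -> q x != 0) ->
  relent p q = (\sum_x p x * ln (p x / q x))%:E.
Proof.
move=> pq; rewrite /relent -sumEFin; apply: eq_bigr => x _.
case: eqVneq => [->|px]; first by rewrite mul0r.
by rewrite (negbTE (pq x px)).
Qed.

(* Gibbs' inequality against [q] renormalised on [M] and left unchanged off
   [M], a measure of total mass at most 2. *)
Lemma sum_mul_ln_div_set_ge {R : realType} {T : finType} (p q : T -> R)
    (M : {set T}) :
  (forall x, 0 <= p x) -> (forall x, 0 <= q x) ->
  \sum_x p x = 1 -> \sum_x q x = 1 ->
  (forall x, p x != 0 -> q x != 0) -> 0 < \sum_(x in M) q x ->
  - (\sum_(x in M) p x) * ln (\sum_(x in M) q x) - 1 <=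
    \sum_x p x * ln (p x / q x).
Proof.
move=> p0 q0 sp sq pq.
set s := \sum_(x in M) q x => s0.
pose u x := if x \in M then q x / s else q x.
have u0 x : 0 <= u x by rewrite /u; case: ifP => // _; rewrite divr_ge0// ltW.
have pu x : p x != 0 -> u x != 0.
  move=> px; rewrite /u; case: ifP => _; last exact: pq.
  by rewrite mulf_neq0 ?invr_eq0 ?gt_eqF// lt_def pq/=.
have := sum_mul_ln_div_ge p u p0 u0 pu.
have : \sum_x u x <= 2.
  rewrite (bigID [in M])/= [X in X + _](_ : _ = 1); last first.
    rewrite (eq_bigr (fun x => q x / s)); last by move=> x xM; rewrite /u xM.
    by rewrite -mulr_suml divff ?gt_eqF.
  rewrite (eq_bigr q); last by move=> x xM; rewrite /u (negbTE xM).
  have -> : 2 = 1 + \sum_x q x :> R by rewrite sq; lra.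
  rewrite lerD2l [leRHS](bigID [in M])/= lerDr; exact: sumr_ge0.
have -> : \sum_x p x * ln (p x / u x) =
    \sum_x p x * ln (p x / q x) + (\sum_(x in M) p x) * ln s.
  rewrite mulr_suml [X in _ + X]big_mkcond/= -big_split/=.
  apply: eq_bigr => x _; rewrite /u; case: ifP => _; last by rewrite addr0.
  have [->|px] := eqVneq (p x) 0; first by rewrite !mul0r addr0.
  have pqx : 0 < p x / q x by rewrite divr_gt0// lt_def ?px ?p0// pq//= q0.
  rewrite (_ : p x / (q x / s) = (p x / q x) * s); last by rewrite invf_div; ring.
  by rewrite (lnM pqx s0) mulrDr.
rewrite sp; lra.
Qed.

(** * Rational laws and products over blocks *)

(** The successor keeps every weight positive, so all logarithms of the law are meaningful; integer
    weights make the family countable. *)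
Definition natlaw (R : realType) {T : finType} (q : {ffun T -> nat}) (x : T) : R :=
  (q x).+1%:R / \sum_y (q y).+1%:R.

Lemma natlaw_gt0 {R : realType} {T : finType} (q : {ffun T -> nat}) (x : T) :
  0 < natlaw R q x.
Proof.
rewrite divr_gt0 ?ltr0n// (bigD1 x)//= ltr_pwDl ?ltr0n//.
by apply: sumr_ge0 => y _; rewrite ler0n.
Qed.

Lemma sum_natlaw {R : realType} {T : finType} (x0 : T) (q : {ffun T -> nat}) :
  \sum_x natlaw R q x = 1.
Proof.
rewrite -mulr_suml divff// gt_eqF//.
rewrite (bigD1 x0)//= ltr_pwDl ?ltr0n//.
by apply: sumr_ge0 => y _; rewrite ler0n.
Qed.

(** Rounding [N * p x] down and adding 1 gives a weight of at least [N * p x], while the weights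
    total at most [N + K]. The loss is a factor [1 + K / N], and [N] is chosen so that
    [K / N <= d]. *)
Lemma natlaw_dominates {R : realType} {T : finType} (p : T -> R) (d : R) :
  (forall x, 0 <= p x) -> \sum_x p x = 1 -> 0 < d ->
  exists q : {ffun T -> nat}, forall x, p x <= expR d * natlaw R q x.
Proof.
move=> p0 sp d0.
pose K : R := #|T|%:R.
pose N : R := K / d + 1.
have K0 : 0 <= K by rewrite ler0n.
have N0 : 0 < N by rewrite ltr_wpDl// divr_ge0// ltW.
have KN : 1 + K / N <= expR d.
  apply: le_trans (expR_ge1Dx _); rewrite lerD2l ler_pdivrMr// mulrDr mulr1.
  by rewrite mulrCA divff ?gt_eqF// mulr1 lerDl ltW.
exists [ffun x => Num.truncn (N * p x)] => x.
set q := [ffun _ => _].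
have Sq : \sum_y (q y).+1%:R <= N + K.
  have -> : N + K = \sum_y (N * p y + 1).
    by rewrite big_split/= -mulr_sumr sp mulr1 sumr_const.
  apply: ler_sum => y _; rewrite ffunE -natr1 lerD2r truncn_le.
  by rewrite mulr_ge0// ltW.
have Sq0 : 0 < \sum_y (q y).+1%:R :> R.
  by rewrite (bigD1 x)//= ltr_pwDl ?ltr0n// sumr_ge0.
rewrite /natlaw mulrA ler_pdivlMr//.
apply: (@le_trans _ _ (p x * (N + K))); first by rewrite ler_wpM2l.
have -> : p x * (N + K) = (1 + K / N) * (N * p x).
  by field; rewrite gt_eqF.
apply: ler_pM => //.
- by rewrite addr_ge0// divr_ge0// ltW.
- by rewrite mulr_ge0// ltW.
by rewrite ffunE ltW// truncnS_gt.
Qed.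

Definition block {A : Type} (a0 : A) (k : nat) (s : seq A) (i : nat) :
  k.-tuple A := [tuple nth a0 s (i * k + j) | j < k].

(* The last, possibly incomplete, block is padded with [a0]. *)
Definition blockprod {R : realType} {A : Type} (a0 : A) {k : nat}
    (p : k.-tuple A -> R) (s : seq A) : R :=
  \prod_(i < (size s %/ k).+1) p (block a0 k s i).

Lemma blockprod_gt0 {R : realType} {A : Type} (a0 : A) {k : nat}
    (p : k.-tuple A -> R) (s : seq A) :
  (forall v, 0 < p v) -> 0 < blockprod a0 p s.
Proof. by move=> p0; apply: prodr_gt0. Qed.

(** Letter [m] sits at place [m %% k] of block [m %/ k <= n %/ k]; the padded block retains the
    trailing letters. *)
Lemma blocks_inj {A : eqType} (a0 : A) (k n : nat) (s t : n.-tuple A) :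
  (0 < k)%N ->
  (forall i : 'I_(n %/ k).+1, block a0 k s i = block a0 k t i) -> s = t.
Proof.
move=> k0 st; apply: eq_from_tnth => m.
have /(congr1 (fun b => tnth b (Ordinal (ltn_pmod m k0)))) :=
  st (Ordinal (leq_div2r k (ltnW (ltn_ord m)) : (m %/ k < (n %/ k).+1)%N)).
by rewrite !tnth_mktuple/= -divn_eq -!tnth_nth.
Qed.

(** Words embed into families of [n %/ k + 1] blocks, on which the product law has mass 1. Families
    with another padding than [a0] lie outside the image, hence the inequality. *)
Lemma sum_blockprod_le1 {R : realType} {A : finType} (a0 : A) {k : nat}
    (p : k.-tuple A -> R) (n : nat) :
  (0 < k)%N -> (forall v, 0 <= p v) -> \sum_v p v = 1 ->
  \sum_(s : n.-tuple A) blockprod a0 p s <= 1.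
Proof.
move=> k0 p0 sp.
pose blocks (s : n.-tuple A) := [ffun i : 'I_(n %/ k).+1 => block a0 k s i].
have blocks_injective : injective blocks.
  move=> s t /ffunP st; apply: (blocks_inj a0 k) => // i.
  by have := st i; rewrite !ffunE.
pose F (f : {ffun 'I_(n %/ k).+1 -> k.-tuple A}) := \prod_i p (f i).
have -> : 1 = \sum_f F f :> R.
  by rewrite /F -(bigA_distr_bigA (fun=> p)) big1.
rewrite (eq_bigr (fun s => F (blocks s))); last first.
  move=> s _; rewrite /blockprod size_tuple.
  by apply: eq_bigr => i _; rewrite ffunE.
rewrite [leRHS](bigID [in codom blocks])/=.
rewrite -[leLHS]addr0; apply: lerD; last by apply: sumr_ge0 => f _; exact: prodr_ge0.
have blocks_uniq : uniq (codom blocks) by rewrite map_inj_uniq ?enum_uniq.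
by rewrite -(big_uniq (codom blocks) blocks_uniq)/= big_map big_enum.
Qed.

(** * Marginals of a process and stationarity *)

Lemma measurable_proj1 {A : finType} (a0 : A) {n : nat} (w : n.-tuple A) :
  measurable (Defs.proj a0 n @^-1` [set w]).
Proof.
apply: sub_sigma_algebra; exists 0, n, w; apply/seteqP; split => x /=.
  by move=> <- i; rewrite tnth_mktuple add0r.
by move=> xw; apply: eq_from_tnth => i; rewrite tnth_mktuple -xw add0r.
Qed.

Lemma proj_preimage_bigcup {A : finType} (a0 : A) {n : nat}
    (M : {set n.-tuple A}) :
  Defs.proj a0 n @^-1` [set w | w \in M] =
  \bigcup_(w in [set` enum M]) (Defs.proj a0 n @^-1` [set w]).
Proof.
apply/seteqP; split => x /=; first by move=> xM; exists (Defs.proj a0 n x) => //=; rewrite mem_enum.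
by move=> [w /=]; rewrite mem_enum => wM ->.
Qed.

Lemma margE {A : finType} {a0 : A} {R : realType} (P : process a0 R) {n : nat}
    (M : {set n.-tuple A}) : marg P M = \sum_(w in M) marg P [set w].
Proof.
have marg1 (w : n.-tuple A) : marg P [set w] = fine (P (Defs.proj a0 n @^-1` [set w])).
  by rewrite /marg; congr (fine (P _)); apply/seteqP; split => x /=;
    rewrite inE => /eqP.
rewrite /marg proj_preimage_bigcup measure_fin_bigcup//; last 2 first.
- by move=> v w _ _ [x [/= -> ->]].
- by move=> w _; exact: measurable_proj1.
rewrite -fsbig_seq ?enum_uniq// -sum_fine; last first.
  by move=> w _; rewrite fin_num_measure//; exact: measurable_proj1.
by rewrite big_enum/=; apply: eq_bigr => w _; rewrite -marg1.
Qed.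

Lemma marg_ge0 {A : finType} {a0 : A} {R : realType} (P : process a0 R)
    {n : nat} (M : {set n.-tuple A}) : 0 <= marg P M.
Proof. by rewrite fine_ge0. Qed.

Lemma marg_setT {A : finType} {a0 : A} {R : realType} (P : process a0 R)
    (n : nat) : marg P [set: n.-tuple A]%SET = 1.
Proof.
rewrite /marg (_ : [set w | w \in _] = setT) ?preimage_setT ?probability_setT//.
by apply/seteqP; split => w //=; rewrite inE.
Qed.

Lemma sum_marg {A : finType} {a0 : A} {R : realType} (P : process a0 R)
    (n : nat) : \sum_(w : n.-tuple A) marg P [set w] = 1.
Proof.
by rewrite -(marg_setT P n) margE; apply: eq_bigl => w; rewrite inE.
Qed.

Lemma marg_setC {A : finType} {a0 : A} {R : realType} (P : process a0 R)
    {n : nat} (M : {set n.-tuple A}) : marg P (~: M) = 1 - marg P M.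
Proof.
rewrite -(sum_marg P n) (bigID [in M])/= -margE addrAC subrr add0r margE.
by apply: eq_bigl => w; rewrite inE.
Qed.

Lemma marg_le1 {A : finType} {a0 : A} {R : realType} (P : process a0 R)
    {n : nat} (M : {set n.-tuple A}) : marg P M <= 1.
Proof. by rewrite -subr_ge0 -marg_setC marg_ge0. Qed.

Definition stationary {A : finType} {a0 : A} {R : realType}
    (P : process a0 R) : Prop :=
  forall S : set (AZ a0), measurable S -> P (Defs.shift a0 @^-1` S) = P S.

Lemma iter_shiftE {A : finType} {a0 : A} (m : nat) (x : AZ a0) (i : int) :
  iter m (Defs.shift a0) x i = x (i + m%:Z).
Proof.
elim: m i => [|m IHm] i /=; first by rewrite addr0.
by rewrite /Defs.shift IHm -addrA -(intS m).
Qed.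

Lemma measurable_iter_shift {A : finType} {a0 : A} (m : nat) {n : nat} (v : n.-tuple A) :
  measurable (iter m (Defs.shift a0) @^-1` (Defs.proj a0 n @^-1` [set v])).
Proof.
apply: sub_sigma_algebra; exists m%:Z, n, v; apply/seteqP; split => x /=.
  by move=> <- i; rewrite tnth_mktuple iter_shiftE addrC.
by move=> xv; apply: eq_from_tnth => i; rewrite tnth_mktuple iter_shiftE -xv addrC.
Qed.

Lemma stationary_iter {A : finType} {a0 : A} {R : realType}
    (P : process a0 R) (m : nat) {n : nat} (v : n.-tuple A) :
  stationary P ->
  P (iter m (Defs.shift a0) @^-1` (Defs.proj a0 n @^-1` [set v])) = P (Defs.proj a0 n @^-1` [set v]).
Proof.
move=> sP; elim: m => [//|m IHm].
rewrite -IHm -(sP _ (measurable_iter_shift m v)); congr (P _).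
by apply/seteqP; split => x; rewrite /preimage/= -iterSr.
Qed.

(* Block [i] of the first [n] letters has, under a stationary [P], the law of
   the first [k] letters. *)
Lemma sum_marg_block {A : finType} {a0 : A} {R : realType} (P : process a0 R)
    (k n i : nat) (f : k.-tuple A -> R) :
  stationary P -> (i * k + k <= n)%N ->
  \sum_(w : n.-tuple A) marg P [set w] * f (block a0 k w i) =
  \sum_(v : k.-tuple A) marg P [set v] * f v.
Proof.
move=> sP ikn.
rewrite (partition_big (fun w : n.-tuple A => block a0 k w i) xpredT)//=.
apply: eq_bigr => v _.
rewrite (eq_bigr (fun w : n.-tuple A => marg P [set w] * f v)); last first.
  by move=> w /eqP ->.
rewrite -mulr_suml; congr (_ * _).
rewrite -[LHS](_ : marg P [set w : n.-tuple A | block a0 k w i == v]%SET = _); last first.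
  by rewrite margE; apply: eq_bigl => w; rewrite inE.
rewrite /marg; congr fine.
have -> : Defs.proj a0 k @^-1` [set w | w \in [set v]%SET] = Defs.proj a0 k @^-1` [set v].
  by apply/seteqP; split => x /=; rewrite inE => /eqP.
rewrite -(stationary_iter P (i * k) v sP); congr (P _).
(* Block [i] reads the first [k] letters of the sequence shifted [i * k] times; [ikn] keeps it clear
   of the padding. *)
have E x : block a0 k (Defs.proj a0 n x) i = Defs.proj a0 k (iter (i * k) (Defs.shift a0) x).
  apply: eq_from_tnth => j; rewrite !tnth_mktuple iter_shiftE.
  have jn : (i * k + j < n)%N by rewrite (leq_trans _ ikn)// ltn_add2l.
  by rewrite -(tnth_nth a0 _ (Ordinal jn)) tnth_mktuple/= PoszD addrC.
by apply/seteqP; split => x /=; rewrite inE E => /eqP.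
Qed.

(** * The countable family of block codes and its universality *)

(** The family [U_j]: [unpickle] enumerates the pairs of a block length [k.+1] and a rational block
    law. An index that codes no pair gives the zero measure. *)
Definition blockcode (R : realType) {A : finType} (a0 : A) (j : nat)
    (s : seq A) : R :=
  oapp (fun c : {k : nat & {ffun k.+1.-tuple A -> nat}} =>
          blockprod a0 (natlaw R (tagged c)) s) 0 (unpickle j).

Lemma blockcode_ge0 {R : realType} {A : finType} (a0 : A) (j : nat)
    (s : seq A) : 0 <= blockcode R a0 j s.
Proof.
rewrite /blockcode; case: unpickle => [[k q]|//] /=.
by apply: ltW; apply: blockprod_gt0 => v; exact: natlaw_gt0.
Qed.

Lemma sum_blockcode_le1 {R : realType} {A : finType} (a0 : A) (j n : nat) :
  \sum_(w : n.-tuple A) blockcode R a0 j w <= 1.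
Proof.
rewrite /blockcode; case: unpickle => [[k q]|] /=; last by rewrite big1.
apply: sum_blockprod_le1 => // [v|]; first exact/ltW/natlaw_gt0.
exact: (sum_natlaw [tuple a0 | _ < k.+1]).
Qed.

Lemma ln_prod_gt0 {R : realType} {I : finType} (f : I -> R) :
  (forall i, 0 < f i) -> ln (\prod_i f i) = \sum_i ln (f i).
Proof.
move=> f0; suff : 0 < \prod_i f i /\ ln (\prod_i f i) = \sum_i ln (f i) by case.
apply: (big_ind2 (fun x y => 0 < x /\ ln x = y)); first by rewrite ln1.
- by move=> x1 x2 y1 y2 [? <-] [? <-]; rewrite mulr_gt0// lnM.
- by move=> i _; rewrite f0.
Qed.

Definition entropy {R : realType} {T : finType} (p : T -> R) : R :=
  \sum_x p x * - ln (p x).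

Lemma entropy_ge0 {R : realType} {T : finType} (p : T -> R) :
  (forall x, 0 <= p x <= 1) -> 0 <= entropy p.
Proof.
move=> p01; apply: sumr_ge0 => x _; have /andP[p0 p1] := p01 x.
by rewrite mulr_ge0// oppr_ge0 ln_le0.
Qed.

Lemma sum_mul_ln_divE {R : realType} {T : finType} (p u : T -> R) :
  (forall x, 0 <= p x) -> (forall x, 0 < u x) ->
  \sum_x p x * ln (p x / u x) = \sum_x p x * - ln (u x) - entropy p.
Proof.
move=> p0 u0; rewrite /entropy -sumrB; apply: eq_bigr => x _.
have [->|px] := eqVneq (p x) 0; first by rewrite !mul0r subr0.
by rewrite ln_div ?posrE// ?lt_def ?px ?p0//; ring.
Qed.

(** Where [p x > 0], domination reads [- ln (u x) <= - ln (p x) + d]; average over [p]. *)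
Lemma cross_entropy_le {R : realType} {T : finType} (p u : T -> R) (d : R) :
  (forall x, 0 <= p x) -> (forall x, 0 < u x) -> \sum_x p x = 1 ->
  (forall x, p x <= expR d * u x) ->
  \sum_x p x * - ln (u x) <= entropy p + d.
Proof.
move=> p0 u0 sp pu.
rewrite -[d in leRHS]mul1r -sp mulr_suml -big_split/=; apply: ler_sum => x _.
have [->|px] := eqVneq (p x) 0; first by rewrite !mul0r addr0.
have px0 : 0 < p x by rewrite lt_def px p0.
rewrite -mulrDr ler_wpM2l// lerNl opprD opprK lerBlDr.
rewrite -[d in leRHS]expRK -lnM ?posrE ?expR_gt0// mulrC ler_ln ?posrE//.
by rewrite mulr_gt0// expR_gt0.
Qed.

(* Coding by independent [k]-blocks: the complete blocks contribute the cross
   entropy of the [k]-marginal each, the padded one a bounded amount. *)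
Lemma cross_entropy_blockprod_le {A : finType} {a0 : A} {R : realType}
    (P : process a0 R) (k n : nat) (p : k.-tuple A -> R) :
  stationary P -> (forall v, 0 < p v <= 1) ->
  \sum_(w : n.-tuple A) marg P [set w] * - ln (blockprod a0 p w) <=
  (n %/ k)%:R * (\sum_(v : k.-tuple A) marg P [set v] * - ln (p v)) +
  \sum_v - ln (p v).
Proof.
move=> sP p01.
have p0 v : 0 < p v by case/andP: (p01 v).
have lnp v : 0 <= - ln (p v).
  by rewrite oppr_ge0 ln_le0//; case/andP: (p01 v).
rewrite (eq_bigr (fun w : n.-tuple A =>
    \sum_(i < n %/ k) marg P [set w] * - ln (p (block a0 k w i)) +
    marg P [set w] * - ln (p (block a0 k w (n %/ k))))); last first.
  move=> w _; rewrite /blockprod ln_prod_gt0// size_tuple big_ord_recr/=.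
  by rewrite opprD mulrDr -sumrN mulr_sumr.
rewrite big_split/= exchange_big/=; apply: lerD.
  rewrite (eq_bigr (fun=> \sum_(v : k.-tuple A) marg P [set v] * - ln (p v))).
    by rewrite sumr_const card_ord mulr_natl.
  move=> i _; rewrite (sum_marg_block P k n i (fun v => - ln (p v)))//.
  by rewrite addnC -mulSn (leq_trans _ (leq_divM n k))// leq_mul2r ltn_ord orbT.
rewrite -[leRHS]mul1r -(sum_marg P n) mulr_suml; apply: ler_sum => w _.
rewrite ler_wpM2l ?marg_ge0// (bigD1 (block a0 k w (n %/ k)))//= lerDl.
exact: sumr_ge0.
Qed.

(* Entropy per letter is approximated from above by its infimum over block
   lengths, so neither subadditivity nor the existence of the entropy rate is
   needed. *)
Lemma near_optimal_blockcode {A : finType} {a0 : A} {R : realType}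
    (P : process a0 R) (d : R) :
  stationary P -> 0 < d ->
  exists j, (forall s, 0 < blockcode R a0 j s) /\
    exists C, 0 <= C /\ forall n,
      \sum_(w : n.-tuple A) marg P [set w] *
        ln (marg P [set w] / blockcode R a0 j w) <= n%:R * (d + d) + C.
Proof.
move=> sP d0.
pose H n := entropy (fun w : n.-tuple A => marg P [set w]).
have H0 n : 0 <= H n.
  by apply: entropy_ge0 => w; rewrite marg_ge0 marg_le1.
pose E := [set H k.+1 / k.+1%:R | k in [set: nat]].
have E0 : lbound E 0 by move=> _ [k _ <-]; rewrite divr_ge0.
have Einf : has_inf E by split; [exists (H 1 / 1), 0%N | exists 0].
have [_ [k _ <-] Hk] := inf_adherent d0 Einf.
(* This lower bound on the entropy of [n] letters cancels the term [n * inf E] of the cross entropy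
   at the end. *)
have sH n : n%:R * inf E <= H n.
  case: n => [|n]; first by rewrite mul0r.
  rewrite mulrC -ler_pdivlMr ?ltr0n//.
  by apply: ge_inf; [exists 0 | exists n].
have [q Pq] := natlaw_dominates (fun v : k.+1.-tuple A => marg P [set v]) d
  (fun v => marg_ge0 P _) (sum_marg P k.+1) d0.
exists (pickle (Tagged (fun k => {ffun k.+1.-tuple A -> nat}) q)).
have -> : blockcode R a0 (pickle (Tagged (fun k => {ffun k.+1.-tuple A -> nat}) q)) =
    blockprod a0 (natlaw R q).
  by apply/funext => s; rewrite /blockcode pickleK.
have q0 v : 0 < natlaw R q v by exact: natlaw_gt0.
have q01 v : 0 < natlaw R q v <= 1.
  rewrite q0/= -(sum_natlaw [tuple a0 | _ < k.+1] q) (bigD1 v)//= lerDl.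
  by apply: sumr_ge0 => u _; exact: ltW.
split; first by move=> s; exact: blockprod_gt0.
exists (\sum_v - ln (natlaw R q v)); split.
  apply: sumr_ge0 => v _; rewrite oppr_ge0 ln_le0//.
  by have /andP[] := q01 v.
move=> n; rewrite sum_mul_ln_divE; last 2 first.
- by move=> w; exact: marg_ge0.
- by move=> w; exact: blockprod_gt0.
have := cross_entropy_blockprod_le P k.+1 n (natlaw R q) sP q01.
have := cross_entropy_le _ _ d (fun v => marg_ge0 P _) q0 (sum_marg P k.+1) Pq.
rewrite -/(H k.+1) => ce.
(* One [d] pays for the near-optimal block length, the other for the rational approximation of the
   block law. *)
have {ce} : (n %/ k.+1)%:R * (\sum_(v : k.+1.-tuple A) marg P [set v] * - ln (natlaw R q v)) <=
    n%:R * (inf E + d + d).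
  apply: (@le_trans _ _ ((n %/ k.+1)%:R * (H k.+1 + d))); first exact: ler_wpM2l.
  have k1 : 1 <= k.+1%:R :> R by rewrite ler1n.
  apply: (@le_trans _ _ ((n %/ k.+1)%:R * (k.+1%:R * (inf E + d + d)))).
    rewrite ler_wpM2l//; move: Hk; rewrite ltr_pdivrMr ?ltr0n// => Hk.
    have : d <= k.+1%:R * d by rewrite ler_peMl// ltW.
    by move: Hk; rewrite mulrC !mulrDr; lra.
  rewrite mulrA -natrM ler_wpM2r ?ler_nat ?leq_divM//.
  by rewrite !addr_ge0 ?(ltW d0)// lb_le_inf//; case: Einf.
by have := sH n; rewrite -/(H n) !mulrDr; lra.
Qed.

Lemma blockcode_universal {A : finType} {a0 : A} {R : realType}
    (P : process a0 R) (t e : R) :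
  stationary P -> 0 < t -> 0 < e ->
  exists j, \forall n \near \oo,
    \sum_(w : n.-tuple A |
      blockcode R a0 j w < expR (- (n%:R * t)) * marg P [set w])
      marg P [set w] <= e.
Proof.
move=> sP t0 e0.
(* The code then costs [n * t * e / 2 + C], and [C + 1] is absorbed by the other half of [n * t * e]
   for large [n]. *)
have d0 : 0 < t * e / 4 by rewrite divr_gt0 ?mulr_gt0.
have [j [j0 [C [C0 jC]]]] := near_optimal_blockcode P (t * e / 4) sP d0.
exists j; near=> n.
have nte : 2 * (C + 1) / (t * e) <= n%:R by near: n; exact: nbhs_infty_ger.
have n0 : 0 < n%:R :> R by rewrite ltr0n; near: n; exact: nbhs_infty_gt.
rewrite -(ler_pM2l (mulr_gt0 n0 t0)).
apply: le_trans (likelihood_ratio_tail (fun w : n.-tuple A => marg P [set w])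
  (fun w => blockcode R a0 j w) (n%:R * t) _ _ (sum_blockcode_le1 a0 j n)) _ => //.
  by move=> w; exact: marg_ge0.
have := jC n; move: nte; rewrite ler_pdivrMr ?mulr_gt0//.
have -> : n%:R * (t * e / 4 + t * e / 4) = n%:R * t * e / 2 :> R by field.
rewrite mulrA; lra.
Unshelve. all: by end_near.
Qed.

(** * Upper and lower limits, logarithms and exponential estimates *)

Lemma ereal_dense {R : realType} (x y : \bar R) :
  (x < y)%E -> exists r : R, (x < r%:E < y)%E.
Proof.
case: x y => [x| |] [y| |] //=.
- by rewrite lte_fin => xy; exists ((x + y) / 2); rewrite !lte_fin; apply/andP; split; lra.
- by move=> _; exists (x + 1); rewrite lte_fin ltry andbT; lra.
- by move=> _; exists (y - 1); rewrite lte_fin ltNyr /=; lra.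
- by move=> _; exists 0; rewrite ltNyr ltry.
Qed.

Lemma limn_esup_le_near {R : realType} (u v : nat -> \bar R) :
  (\forall n \near \oo, (u n <= v n)%E) -> (limn_esup u <= limn_esup v)%E.
Proof.
move=> uv; apply: le_ereal_inf_tmp => _ [V oV <-].
apply: ge_ereal_inf; exists (ereal_sup [set u n | n in V `&` [set n | (u n <= v n)%E]]).
  by exists (V `&` [set n | (u n <= v n)%E]) => //; exact: filterI.
apply: ge_ereal_sup => _ [n [Vn uvn] <-]; apply: le_trans uvn _.
by apply: ereal_sup_ubound; exists n.
Qed.

Lemma limn_esup_lt_near {R : realType} (u : nat -> \bar R) (l : \bar R) :
  (limn_esup u < l)%E -> \forall n \near \oo, (u n < l)%E.
Proof.
move=> /ereal_inf_lt[_ [V oV <-] Vl]; apply: filterS oV => n Vn.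
by apply: le_lt_trans Vl; apply: ereal_sup_ubound; exists n.
Qed.

Lemma limn_esup_le_cst_near {R : realType} (u : nat -> \bar R) (l : \bar R) :
  (\forall n \near \oo, (u n <= l)%E) -> (limn_esup u <= l)%E.
Proof.
move=> ul; apply: le_trans (limn_esup_le_near u (fun=> l) ul) _.
by have [_ ->] := cvg_limn_einf_sup (@cvg_cst _ l _ \oo _).
Qed.

Lemma limn_einf_ge_cst_near {R : realType} (u : nat -> \bar R) (l : \bar R) :
  (\forall n \near \oo, (l <= u n)%E) -> (l <= limn_einf u)%E.
Proof.
move=> lu; rewrite /limn_einf leeNr; apply: limn_esup_le_cst_near.
by apply: filterS lu => n; rewrite leeN2.
Qed.

Lemma elog_le {R : realType} (x y : R) : x <= expR y -> (elog x <= y%:E)%E.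
Proof.
rewrite /elog; case: ifPn => x0 xy; last by rewrite leNye.
by rewrite lee_fin -[y]expRK ler_ln ?posrE ?expR_gt0.
Qed.

Lemma elog_ge {R : realType} (x y : R) : expR y <= x -> (y%:E <= elog x)%E.
Proof.
move=> yx; have x0 : 0 < x by rewrite (lt_le_trans (expR_gt0 y)).
by rewrite /elog x0 lee_fin -[y]expRK ler_ln ?posrE ?expR_gt0.
Qed.

Lemma elog_lt {R : realType} (x y : R) : (elog x < y%:E)%E -> x < expR y.
Proof. by move=> xy; rewrite ltNge; apply: contraTN xy => /elog_ge; rewrite leNgt. Qed.

Lemma near_expRN_le {R : realType} (t e : R) : 0 < t -> 0 < e ->
  \forall n \near \oo, expR (- (n%:R * t)) <= e.
Proof.
move=> t0 e0; near=> n.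
have : 1 / (t * e) <= n%:R by near: n; exact: nbhs_infty_ger.
rewrite ler_pdivrMr ?mulr_gt0// => nte.
rewrite expRN invf_ple ?posrE ?expR_gt0//.
apply: le_trans (expR_ge1Dx _).
have : e^-1 <= n%:R * t by rewrite -[e^-1]div1r ler_pdivrMr// -mulrA.
lra.
Unshelve. all: by end_near.
Qed.

Lemma near_natr_le_expR {R : realType} (d : R) : 0 < d ->
  \forall n \near \oo, n%:R <= expR (n%:R * d).
Proof.
move=> d0; near=> n.
(* Beyond this threshold the quadratic term [(n * d)^2 / 2] of the exponential already exceeds
   [n]. *)
have : 2 / d ^+ 2 <= n%:R by near: n; exact: nbhs_infty_ger.
rewrite ler_pdivrMr ?exprn_gt0// => nd.
have nd0 : 0 <= n%:R * d by rewrite mulr_ge0// ltW.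
apply: le_trans (expR_ge1Dxn 1 nd0).
have : n%:R * 2 <= n%:R * (n%:R * d ^+ 2) by rewrite ler_wpM2l.
by rewrite exprMn (_ : 2`! = 2%N)//; lra.
Unshelve. all: by end_near.
Qed.

(** * The universal sets: size under [Q], typicality under [P] *)

(** The range of codes grows with [n]: each fixed code is eventually included, yet the union bound
    loses only a factor [n]. *)
Definition universal_set {A : finType} {a0 : A} {R : realType}
    (Q : process a0 R) (c : R) (n : nat) : {set n.-tuple A} :=
  [set w | [exists j : 'I_n,
    marg Q [set w] <= expR (- (n%:R * c)) * blockcode R a0 j w]]%SET.

Lemma marg_universal_set_le {A : finType} {a0 : A} {R : realType}
    (Q : process a0 R) (c : R) (n : nat) :
  marg Q (universal_set Q c n) <= n%:R * expR (- (n%:R * c)).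
Proof.
rewrite margE.
apply: (@le_trans _ _ (\sum_(w : n.-tuple A) \sum_(j < n)
    expR (- (n%:R * c)) * blockcode R a0 j w)).
  rewrite big_mkcond; apply: ler_sum => w _; case: ifPn => [|_]; last first.
    by apply: sumr_ge0 => j _; rewrite mulr_ge0 ?expR_ge0 ?blockcode_ge0.
  rewrite inE => /existsP[j Qj]; apply: le_trans Qj _.
  rewrite (bigD1 j)//= lerDl.
  by apply: sumr_ge0 => i _; rewrite mulr_ge0 ?expR_ge0 ?blockcode_ge0.
have -> : n%:R * expR (- (n%:R * c)) = \sum_(j < n) expR (- (n%:R * c)).
  by rewrite sumr_const card_ord mulr_natl.
rewrite exchange_big/=; apply: ler_sum => j _; rewrite -mulr_sumr.
by rewrite -[leRHS]mulr1 ler_wpM2l ?expR_ge0// sum_blockcode_le1.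
Qed.

Lemma limn_esup_lograte_universal_set {A : finType} {a0 : A} {R : realType}
    (Q : process a0 R) (c d : R) : 0 < d ->
  (limn_esup (lograte Q (universal_set Q (c + d))) <= (- c)%:E)%E.
Proof.
move=> d0; apply: limn_esup_le_cst_near; near=> n.
have n0 : 0 < n%:R :> R by rewrite ltr0n; near: n; exact: nbhs_infty_gt.
rewrite /lograte lee_pdivrMl// -EFinM; apply: elog_le.
apply: le_trans (marg_universal_set_le _ _ _) _.
apply: (@le_trans _ _ (expR (n%:R * d) * expR (- (n%:R * (c + d))))).
  by rewrite ler_wpM2r ?expR_ge0//; near: n; exact: near_natr_le_expR.
by rewrite -expRD ler_expR; lra.
Unshelve. all: by end_near.
Qed.

(** The Stein property yields [M] with [P(M) >= 1 - eps] and [Q(M) < exp (- n (c + 2 t))]. Words of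
    small ratio have [P]-mass at most [eps] off [M], and at most
    [exp (n (c + t)) * Q(M) <= exp (- n t)] on [M]. *)
Lemma likelihood_ratio_typical {A : finType} {a0 : A} {R : realType}
    (P Q : process a0 R) (c t e : R) :
  (forall eps : R, 0 < eps < 1 -> (betabar eps P Q <= - hrate P Q)%E) ->
  ((c + (t + t))%:E < hrate P Q)%E -> 0 < t -> 0 < e ->
  \forall n \near \oo,
    \sum_(w : n.-tuple A | marg P [set w] <= expR (n%:R * (c + t)) * marg Q [set w])
      marg P [set w] <= e.
Proof.
move=> stein ch t0 e0.
pose eps := Num.min (e / 2) (1 / 2).
have eps01 : 0 < eps < 1 by rewrite /eps lt_min gt_min; lra.
have epse : eps <= e / 2 by rewrite /eps ge_min lexx.
have : (betabar eps P Q < (- (c + (t + t)))%:E)%E.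
  by apply: le_lt_trans (stein eps eps01) _; rewrite EFinN lteN2.
move=> /limn_esup_lt_near beta_lt; near=> n.
have n0 : 0 < n%:R :> R by rewrite ltr0n; near: n; exact: nbhs_infty_gt.
have : ((n%:R^-1)%:E * beta eps P Q n < (- (c + (t + t)))%:E)%E by near: n.
rewrite lte_pdivrMl// -EFinM => /ereal_inf_lt[_ [M /= PM <-] /elog_lt QM].
rewrite (bigID [in M])/=.
apply: (@le_trans _ _ (e / 2 + e / 2)); last by lra.
rewrite addrC; apply: lerD.
  apply: (@le_trans _ _ (marg P (~: M))); last by rewrite marg_setC; lra.
  rewrite margE [leRHS]big_mkcond [leLHS]big_mkcond/=.
  apply: ler_sum => w _; rewrite inE; case: (w \in M) => /=; first by rewrite andbF.
  by rewrite andbT; case: ifP => // _; exact: marg_ge0.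
apply: (@le_trans _ _ (expR (n%:R * (c + t)) * marg Q M)).
  rewrite margE mulr_sumr [leLHS]big_mkcond [leRHS]big_mkcond/=.
  apply: ler_sum => w _; case: (w \in M) => /=; last by rewrite andbF.
  rewrite andbT; case: ifP => // _.
  by rewrite mulr_ge0 ?expR_ge0 ?marg_ge0.
apply: (@le_trans _ _ (expR (- (n%:R * t)))).
  apply: (@le_trans _ _ (expR (n%:R * (c + t)) * expR (n%:R * - (c + (t + t))))).
    by rewrite ler_wpM2l ?expR_ge0// ltW.
  by rewrite -expRD ler_expR; lra.
by near: n; apply: near_expRN_le => //; lra.
Unshelve. all: by end_near.
Qed.

(** A word outside the set, once [j < n], either has a small likelihood ratio against [Q] or is
    badly coded by [U_j]: otherwise [Q w <= exp (- n (c + t)) * P w <= exp (- n c) * U_j w]. Both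
    exceptional masses are eventually at most [e / 2]. *)
Lemma marg_universal_set_cvg {A : finType} {a0 : A} {R : realType}
    (P Q : process a0 R) (c : R) :
  stationary P ->
  (forall eps : R, 0 < eps < 1 -> (betabar eps P Q <= - hrate P Q)%E) ->
  (c%:E < hrate P Q)%E ->
  marg P (universal_set Q c n) @[n --> \oo] --> (1 : R).
Proof.
move=> sP stein /ereal_dense[r /andP[cr rh]]; rewrite lte_fin in cr.
pose t := (r - c) / 2; have t0 : 0 < t by rewrite /t; lra.
have ch : ((c + (t + t))%:E < hrate P Q)%E.
  by rewrite (_ : c + (t + t) = r)// /t; lra.
apply/cvgrPdist_le => e e0.
have e20 : 0 < e / 2 by lra.
have [j Pj] := blockcode_universal P t (e / 2) sP t0 e20.
near=> n.
rewrite ger0_norm ?subr_ge0 ?marg_le1// -marg_setC margE.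
have jn : (j < n)%N by near: n; exact: nbhs_infty_gt.
apply: (@le_trans _ _ (e / 2 + e / 2)); last by lra.
apply: le_trans (lerD (_ : \sum_(w : n.-tuple A | marg P [set w] <= expR (n%:R * (c + t)) * marg Q [set w])
      marg P [set w] <= e / 2) (_ : \sum_(w : n.-tuple A |
      blockcode R a0 j w < expR (- (n%:R * t)) * marg P [set w])
      marg P [set w] <= e / 2)); last 2 first.
- by near: n; exact: likelihood_ratio_typical.
- by near: n.
rewrite [leLHS]big_mkcond [X in X + _]big_mkcond [X in _ + X]big_mkcond/=.
rewrite -big_split/=; apply: ler_sum => w _; have Pw := marg_ge0 P [set w].
case: ifPn => [|_]; last by case: ifP; case: ifP => _ _; rewrite ?addr0 ?add0r ?addr_ge0.
rewrite !inE => /existsPn/(_ (Ordinal jn))/= QU.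
case: ifPn => [_|]; first by rewrite lerDl; case: ifP.
rewrite -ltNge => QP; case: ifPn => [_|]; first by rewrite add0r.
rewrite -leNgt => PU; case/negP: QU.
apply: (@le_trans _ _ (expR (- (n%:R * (c + t))) * marg P [set w])).
  by rewrite expRN ler_pdivlMl ?expR_gt0// ltW.
apply: (@le_trans _ _ (expR (- (n%:R * c)) * (expR (- (n%:R * t)) * marg P [set w]))).
  by rewrite mulrA -expRD ler_wpM2r// ler_expR; lra.
by rewrite ler_wpM2l ?expR_ge0.
Unshelve. all: by end_near.
Qed.

(** * Lower bound on the rate of typical sets *)

Lemma hrate_cvg {A : finType} {a0 : A} {R : realType} (P Q : process a0 R) :
  h_exists P Q -> relent_rate P Q @ \oo --> hrate P Q.
Proof. by move=> [l Pl]; rewrite /hrate (cvg_lim _ Pl). Qed.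

Lemma limn_einf_lograte_ge {A : finType} {a0 : A} {R : realType}
    (P Q : process a0 R) (M : forall n, {set n.-tuple A}) :
  h_exists P Q -> marg P (M n) @[n --> \oo] --> (1 : R) ->
  (- hrate P Q <= limn_einf (lograte Q M))%E.
Proof.
move=> hPQ PM; rewrite leNgt; apply/negP => /ereal_dense[l /andP[Ml lh]].
suff /(lt_le_trans Ml) : (l%:E <= limn_einf (lograte Q M))%E by rewrite ltxx.
have : (hrate P Q < (- l)%:E)%E by rewrite EFinN lteNr.
move=> /ereal_dense[a /andP[ha al]]; rewrite lte_fin in al.
have /limn_esup_lt_near Ha : (limn_esup (relent_rate P Q) < a%:E)%E.
  by have [_ ->] := cvg_limn_einf_sup (hrate_cvg P Q hPQ).
(* Half of the gap between [a] and [- l] absorbs the constant 1 of the data-processing bound, the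
   other half the defect of [P(M n)] from 1. *)
pose d := (- l - a) / 2; have d0 : 0 < d by rewrite /d; lra.
apply: limn_einf_ge_cst_near; near=> n.
have n0 : 0 < n%:R :> R by rewrite ltr0n; near: n; exact: nbhs_infty_gt.
have nd : d^-1 <= n%:R by near: n; exact: nbhs_infty_ger.
have PM0 : 0 < marg P (M n).
  by near: n; apply: (cvgr_gt _ PM); exact: ltr01.
have lP : a + d < - l * marg P (M n).
  near: n; apply: (cvgr_gt (- l * 1)); last by rewrite /d; lra.
  by apply: cvgM => //; exact: cvg_cst.
have : (relent_rate P Q n < a%:E)%E by near: n.
rewrite /relent_rate lte_pdivrMl// -EFinM => Hn.
have PQ := relent_lty _ _ (lt_trans Hn (ltry _)).
rewrite relentE// lte_fin in Hn.
(* Finite relative entropy makes [P] absolutely continuous with respect to [Q] on words, so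
   [Q(M n) = 0] would force [P(M n) = 0]. *)
have QM0 : 0 < marg Q (M n).
  rewrite lt_def marg_ge0 andbT; apply: contraTneq PM0 => QM0.
  rewrite -leNgt margE big1// => w wM; apply/eqP; apply: contraTT isT => /PQ/eqP; case.
  apply/eqP; rewrite -[_ == _]andTb -wM.
  move: QM0; rewrite margE => /eqP; rewrite psumr_eq0; last by move=> *; exact: marg_ge0.
  by move=> /allP/(_ w (mem_index_enum w)); rewrite wM.
have := sum_mul_ln_div_set_ge _ _ (M n) (fun w => marg_ge0 P _) (fun w => marg_ge0 Q _)
  (sum_marg P n) (sum_marg Q n) PQ.
rewrite -!margE => /(_ QM0) key.
rewrite /lograte lee_pdivlMl// -EFinM; apply: elog_ge.
rewrite -[leRHS](@lnK R) ?posrE// ler_expR -(ler_pM2r PM0).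
have : 1 <= n%:R * d by rewrite -ler_pdivrMr// div1r.
have : n%:R * (a + d) <= n%:R * (- l * marg P (M n)) by rewrite ler_wpM2l// ltW.
move: key Hn; lra.
Unshelve. all: by end_near.
Qed.

(** * Equivalence of the Stein and the Sanov property *)

Theorem mainTheorem2 (A : finType) (a0 : A) (R : realType)
  (Q : process a0 R) (Theta : set (process a0 R))
  (Herg : forall P, Theta P -> ergodic P)
  (Hex : forall P, Theta P -> h_exists P Q) :
  (forall P, Theta P -> forall eps : R, 0 < eps < 1 ->
     (betabar eps P Q <= - hrate P Q)%E)
  <->
  (forall Om : set (process a0 R), Om `<=` Theta ->
   forall eta : R, 0 < eta ->
     (exists M : forall n : nat, {set n.-tuple A},
        (forall P, Om P -> marg P (M n) @[n --> \oo] --> (1 : R)) /\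
        ((hset Om Q < +oo)%E ->
           (limn_esup (lograte Q M) <= - hset Om Q + eta%:E)%E) /\
        (hset Om Q = +oo%E ->
           (limn_esup (lograte Q M) <= (- eta^-1)%:E)%E)) /\
     (forall Mt : forall n : nat, {set n.-tuple A},
        (forall P, Om P -> marg P (Mt n) @[n --> \oo] --> (1 : R)) ->
        (- hset Om Q <= limn_einf (lograte Q Mt))%E)).
Proof.
split=> [stein Om OmT eta eta0|sanov P TP eps /andP[eps0 eps1]].
  (* A level below the infimum lies below every [hrate P Q], so one sequence of sets serves all of
     [Om]. *)
  have cvgM c : (c%:E < hset Om Q)%E -> forall P, Om P ->
      marg P (universal_set Q c n) @[n --> \oo] --> (1 : R).
    move=> cOm P OmP; apply: marg_universal_set_cvg.
    - by have [] := Herg P (OmT P OmP).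
    - exact/stein/OmT.
    - by apply: lt_le_trans cOm _; apply: ereal_inf_lbound; exists P.
  split; last first.
    move=> Mt cvgMt; rewrite leeNl; apply: le_ereal_inf_tmp => _ [P OmP <-].
    by rewrite leeNl; apply: limn_einf_lograte_ge; [exact/Hex/OmT | exact: cvgMt].
  case: (hset Om Q) cvgM => [h| |] cvgM.
  (* Half of [eta] puts the level strictly below [h], the other half absorbs the factor [n]. *)
  - exists (universal_set Q (h - eta / 2)); split.
      by apply: cvgM; rewrite lte_fin; lra.
    split=> // _; rewrite (_ : h - eta / 2 = (h - eta) + eta / 2); last by lra.
    rewrite -EFinN -EFinD (_ : - h + eta = - (h - eta)); last by lra.
    by apply: limn_esup_lograte_universal_set; lra.
  - exists (universal_set Q (eta^-1 + 1)); split; first by apply: cvgM; rewrite ltry.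
    by split=> // _; apply: limn_esup_lograte_universal_set.
  (* For [hset Om Q = -oo] the required upper bound is [+oo], so all words will do. *)
  - exists (fun n => [set: n.-tuple A]%SET); split.
      move=> P _; under eq_fun do rewrite marg_setT; exact: cvg_cst.
    by split=> // _; rewrite /= leey.
have P_Theta : [set P] `<=` Theta by move=> _ ->.
have sanovP eta := sanov [set P] P_Theta eta.
have hP : hset [set P] Q = hrate P Q by rewrite /hset image_set1 ereal_inf1.
(* Since [P(M n)] tends to 1, [M n] eventually competes in the minimum that defines [beta]. *)
have betabar_le (M : forall n, {set n.-tuple A}) :
    (forall P', [set P] P' -> marg P' (M n) @[n --> \oo] --> (1 : R)) ->
    (betabar eps P Q <= limn_esup (lograte Q M))%E.
  move=> /(_ P erefl) PM; apply: limn_esup_le_near; near=> n.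
  have n0 : 0 < n%:R :> R by rewrite ltr0n; near: n; exact: nbhs_infty_gt.
  rewrite /lograte lee_pmul2l ?lte_fin ?invr_gt0//.
  apply: ereal_inf_lbound; exists (M n) => //=; apply: ltW.
  by near: n; apply: (cvgr_gt _ PM); lra.
rewrite hP in sanovP; case: (hrate P Q) sanovP => [h| |] sanovP.
- apply/lee_addgt0Pr => eta eta0.
  have [[M [PM [+ _]]] _] := sanovP eta eta0.
  by move=> /(_ (ltry _)); apply: le_trans; exact: betabar_le.
- rewrite leNgt; apply/negP => /ereal_dense[r /andP[_ rb]].
  have r0 : 0 < `|r| + 1 by rewrite ltr_wpDl.
  (* With this [eta] the bound [- 1 / eta] equals [- |r| - 1 < r], against [r < betabar eps P Q]. *)
  have [[M [PM [_ +]]] _] := sanovP (`|r| + 1)^-1 (etrans (invr_gt0 _) r0).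
  move=> /(_ erefl); apply/negP; rewrite -ltNge invrK.
  apply: lt_le_trans (betabar_le M PM); apply: le_lt_trans rb.
  by rewrite lee_fin; have := ler_norm (- r); rewrite normrN; lra.
- by rewrite /= leey.
Unshelve. all: by end_near.
Qed.
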